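(* Let $n \ge 1$. There exist a constant $c_n$ depending only on $n$ and $n+1$ dyadic filtrations $\mathcal{A}_0, \mathcal{A}_1, \ldots, \mathcal{A}_n$ of $\mathbb{R}^n$ such that every Euclidean ball $B \subset \mathbb{R}^n$ is contained in some cube $Q \in \bigcup_{m=0}^n \mathcal{A}_m$ satisfying $\mathrm{diam}(Q) \le c_n \, \mathrm{diam}(B)$. Moreover, the number $n+1$ of dyadic filtrations is optimal: for no family of $n$ (or fewer) dyadic filtrations of $\mathbb{R}^n$ does there exist a finite constant $c$ such that every Euclidean ball $B$ is contained in some cube $Q$ of one of the filtrations with $\mathrm{diam}(Q) \le c \, \mathrm{diam}(B)$.
   Context: A dyadic filtration (or dyadic system) of $\mathbb{R}^n$ is a family $\mathcal{A} = \bigcup_{k \in \mathbb{Z}} \mathcal{A}(k)$, with $\mathcal{A}(k) = \{Q_{jk} : j \in \mathbb{Z}^n\}$, where the $Q_{jk}$ are half-open cubes with sides parallel to the axes (products of intervals of the form $[a_i, a_i+\ell)$), satisfying: (1) the side length of $Q_{jk}$ is $2^{-k}$; (2) for each $k \in \mathbb{Z}$ the $k$-th generation $\mathcal{A}(k)$ is a partition of $\mathbb{R}^n$; (3) any two cubes in the filtration are either disjoint or nested. *)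

(* Defs.v *)
(* Points of R^n are row vectors. *)
From HB Require Import structures.
From mathcomp Require Import all_boot all_order all_algebra.
From mathcomp Require Import all_classical all_reals all_analysis.

Set Implicit Arguments.
Unset Strict Implicit.
Unset Printing Implicit Defensive.

Import Order.TTheory GRing.Theory Num.Theory.

Local Open Scope classical_set_scope.
Local Open Scope ring_scope.

(* The library norm on 'rV[R]_n is the sup norm, and its balls are cubes;
   hence these Euclidean versions. *)
Definition eucl_dist (R : realType) (n : nat) (x y : 'rV[R]_n) : R :=
  Num.sqrt (\sum_(i < n) (x 0 i - y 0 i) ^+ 2).

Definition eucl_ball (R : realType) (n : nat) (x : 'rV[R]_n) (r : R) :
    set 'rV[R]_n :=
  [set y | eucl_dist x y < r].

(* Meaningful for nonempty bounded A only: [sup] is 0 otherwise. *)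
Definition diam (R : realType) (n : nat) (A : set 'rV[R]_n) : R :=
  sup [set eucl_dist x y | x in A & y in A].

Definition half_open_cube (R : realType) (n : nat) (a : 'rV[R]_n) (l : R) :
    set 'rV[R]_n :=
  [set x : 'rV[R]_n | forall i : 'I_n, x 0 i \in `[a 0 i, a 0 i + l[].

Definition cube_system (R : realType) (n : nat) :=
  int -> 'rV[int]_n -> set 'rV[R]_n.

Definition generation (R : realType) (n : nat) (Q : cube_system R n) (k : int) :
    set (set 'rV[R]_n) :=
  range (Q k).

Definition cubes (R : realType) (n : nat) (Q : cube_system R n) :
    set (set 'rV[R]_n) :=
  \bigcup_(k in [set: int]) generation Q k.

(* A generation is partitioned as a set of cubes: the indexing by Z^n need not
   be injective. *)
Definition dyadic_filtration (R : realType) (n : nat) (Q : cube_system R n) :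
    Prop :=
  [/\ forall (k : int) (j : 'rV[int]_n),
        exists a : 'rV[R]_n, Q k j = half_open_cube a ((2 : R) ^ (- k)),
      forall k : int, partition (generation Q k) id [set: 'rV[R]_n]
    & forall P P' : set 'rV[R]_n, cubes Q P -> cubes Q P' ->
        [\/ P `&` P' = set0, P `<=` P' | P' `<=` P]].

Definition covers_balls (R : realType) (n m : nat)
    (A : 'I_m -> cube_system R n) (c : R) : Prop :=
  forall (x : 'rV[R]_n) (r : R), 0 < r ->
    exists P : set 'rV[R]_n,
      [/\ (\bigcup_(i in [set: 'I_m]) cubes (A i)) P,
          eucl_ball x r `<=` P
        & diam P <= c * diam (eucl_ball x r)].

(* Main.v *)
Require Import Defs.
From mathcomp Require Import all_boot all_order all_algebra.
From mathcomp Require Import all_classical all_reals all_analysis.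
From mathcomp Require Import ring lra zify.

(** Existence.  A filtration whose cubes of generation [k] are the cells of the
    lattice with corners in [2^-k (Z + theta_k)^n] is dyadic as soon as the
    phases satisfy [theta_(k+1) = 2 theta_k] modulo 1, so that each lattice
    refines the previous one ([shifted_grid_dyadic]).  Suppose that [n+1] such
    phases are, in every generation, at distance at least [e] from each other
    modulo 1.  A ball of diameter less than [e 2^-k] projects on each axis to an
    interval that meets the endpoints of at most one of the [n+1] grids of
    generation [k]; the [n] axes thus discard at most [n] grids, and a cube of
    the remaining one contains the ball ([shifted_grids_cover]).  With
    [p = 2n+1], an odd number, 2 is invertible modulo [p], and the phases
    [theta_k = 2^k i / p] for [i = 0, ..., n] are coherent for all [k] in [Z]
    and [1/p]-separated ([phase_coherent], [phase_separated]).

    Optimality.  For [m <= n] filtrations, it suffices to find a point lying, for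
    each of them, on the boundary between cubes of a bounded generation: a cube
    that contains a ball around this point, however small, is then of
    side at least some fixed [d].  The [i]-th coordinate of the point takes care
    of the [i]-th filtration.  The difficulty is that a filtration need not be a
    single grid of [R^n]: different parts of the space may carry unrelated
    grids.  However, the mid-hyperplane of a cube [Q] orthogonal to any axis is
    crossed by no proper descendant of [Q] ([child_avoids_mid_hyperplane]).
    One therefore chooses cubes [Q_0, Q_1, ...], one in each filtration and
    rapidly shrinking, freezing at stage [i] the coordinate [i] of the point to
    that of the centre of [Q_i], and recentring the coordinates that are still
    free so that all later choices stay inside [Q_i]
    ([common_boundary_point]). *)

Set Implicit Arguments.
Unset Strict Implicit.
Unset Printing Implicit Defensive.

Import Order.TTheory GRing.Theory Num.Theory.

Local Open Scope classical_set_scope.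
Local Open Scope ring_scope.

(** * Euclidean distance against coordinates *)

Lemma ler_coord_eucl_dist (R : realType) (n : nat) (x y : 'rV[R]_n) (i : 'I_n) :
  `|x 0 i - y 0 i| <= eucl_dist x y.
Proof.
rewrite -sqrtr_sqr; apply: ler_wsqrtr.
by rewrite (bigD1 i) //= lerDl; apply: sumr_ge0 => j _; exact: sqr_ge0.
Qed.

Lemma eucl_dist_le (R : realType) (n : nat) (x y : 'rV[R]_n) (d : R) :
  0 <= d -> (forall i, `|x 0 i - y 0 i| <= d) -> eucl_dist x y <= n%:R * d.
Proof.
move=> d0 xy.
have nd0 : 0 <= n%:R * d by rewrite mulr_ge0.
rewrite -(ger0_norm nd0) -sqrtr_sqr; apply: ler_wsqrtr.
apply: (@le_trans _ _ (\sum_(i < n) d ^+ 2)).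
  apply: ler_sum => i _; rewrite -real_normK ?num_real//.
  by rewrite lerXn2r ?nnegrE.
rewrite sumr_const card_ord exprMn -[leLHS]mulr_natl ler_wpM2r ?sqr_ge0//.
by rewrite -natrX ler_nat; case: n {x y xy nd0} => // k; rewrite -mulnn leq_pmulr.
Qed.

Lemma diam_le (R : realType) (n : nat) (A : set 'rV[R]_n) (d : R) :
  0 <= d ->
  (forall x y, A x -> A y -> forall i, `|x 0 i - y 0 i| <= d) ->
  diam A <= n%:R * d.
Proof.
move=> d0 Ad; have [[x Ax]|/set0P/negP/negPn/eqP A0] := pselect (A !=set0).
  apply: ge_sup; first by exists (eucl_dist x x), x => //; exists x.
  by move=> _ [y Ay [z Az <-]]; apply: eucl_dist_le => //; exact: Ad.
rewrite /diam (_ : [set _ | _ in _ & _ in _] = set0) ?sup0 ?mulr_ge0//.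
by rewrite A0; apply/seteqP; split => // ? [? []].
Qed.

Lemma le_diam (R : realType) (n : nat) (A : set 'rV[R]_n) (d : R)
    (x y : 'rV[R]_n) (i : 'I_n) :
  (forall x y, A x -> A y -> forall i, `|x 0 i - y 0 i| <= d) ->
  A x -> A y -> `|x 0 i - y 0 i| <= diam A.
Proof.
move=> Ad Ax Ay; apply: (le_trans (ler_coord_eucl_dist x y i)).
apply: ub_le_sup; last by exists x => //; exists y.
exists (n%:R * d) => _ [u Au [v Av <-]]; apply: eucl_dist_le; last exact: Ad.
by apply: le_trans (Ad _ _ Ax Ay i).
Qed.

Lemma eucl_ball_center (R : realType) (n : nat) (x : 'rV[R]_n) (r : R) :
  0 < r -> eucl_ball x r x.
Proof.
rewrite /eucl_ball /= /eucl_dist big1 ?sqrtr0// => i _.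
by rewrite subrr expr0n.
Qed.

Lemma eucl_ball_shift (R : realType) (n : nat) (x : 'rV[R]_n) (r e : R)
    (i : 'I_n) :
  `|e| < r -> eucl_ball x r (x + e *: delta_mx 0 i).
Proof.
move=> er; rewrite /eucl_ball /= /eucl_dist (bigD1 i) //= big1 => [|j ji].
  by rewrite addr0 !mxE !eqxx opprD addNKr mulr1 sqrrN sqrtr_sqr.
by rewrite !mxE (negPf ji) andbF mulr0 addr0 subrr expr0n.
Qed.

Lemma eucl_ball_bound (R : realType) (n : nat) (x : 'rV[R]_n) (r : R)
    (y z : 'rV[R]_n) (i : 'I_n) :
  eucl_ball x r y -> eucl_ball x r z -> `|y 0 i - z 0 i| <= 2 * r.
Proof.
rewrite /eucl_ball /= => xy xz.
have := le_lt_trans (ler_coord_eucl_dist x y i) xy.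
have := le_lt_trans (ler_coord_eucl_dist x z i) xz.
rewrite !ltr_norml ler_norml => /andP[? ?] /andP[? ?]; lra.
Qed.

Lemma half_open_cube_bound (R : realType) (n : nat) (a : 'rV[R]_n) (l : R)
    (y z : 'rV[R]_n) (i : 'I_n) :
  half_open_cube a l y -> half_open_cube a l z -> `|y 0 i - z 0 i| <= l.
Proof.
move=> /(_ i) + /(_ i); rewrite !in_itv /= ler_norml => /andP[? ?] /andP[? ?].
lra.
Qed.

Lemma diam_eucl_ball_ge (R : realType) (n : nat) (x : 'rV[R]_n) (r : R) :
  (0 < n)%N -> 0 < r -> r / 2 <= diam (eucl_ball x r).
Proof.
move=> n0 r0; pose i := Ordinal n0; have r2 : 0 <= r / 2 by lra.
have Bs : eucl_ball x r (x + (r / 2) *: delta_mx 0 i).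
  by apply: eucl_ball_shift; rewrite ger0_norm //; lra.
apply: le_trans (@le_diam _ _ _ (2 * r) _ x i _ Bs (eucl_ball_center _ r0)).
  by rewrite !mxE !eqxx mulr1 addrAC subrr add0r ger0_norm.
by move=> y z Ay Az j; exact: eucl_ball_bound Ay Az.
Qed.

Lemma diam_half_open_cube_ge (R : realType) (n : nat) (a : 'rV[R]_n) (l : R) :
  (0 < n)%N -> 0 < l -> l / 2 <= diam (half_open_cube a l).
Proof.
move=> n0 l0; pose i := Ordinal n0; have l2 : 0 <= l / 2 by lra.
have Qa : half_open_cube a l a by move=> j; rewrite in_itv /=; lra.
have Qs : half_open_cube a l (a + (l / 2) *: delta_mx 0 i).
  move=> j; rewrite in_itv !mxE /=.
  by case: (j == i); rewrite ?(mulr1, mulr0) /=; lra.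
apply: le_trans (@le_diam _ _ _ l _ a i _ Qs Qa).
  by rewrite !mxE !eqxx mulr1 addrAC subrr add0r ger0_norm.
by move=> y z Ay Az j; exact: half_open_cube_bound Ay Az.
Qed.

(** * Dyadic side lengths *)

Definition side (R : realType) (k : int) : R := 2 ^ (- k).
Arguments side {R}.

Lemma side_gt0 (R : realType) (k : int) : 0 < side k :> R.
Proof. by apply: exprz_gt0; rewrite ltr0n. Qed.

Lemma sideS (R : realType) (k : int) : side k = 2 * side (k + 1) :> R.
Proof.
have two0 : (2 : R) != 0 by rewrite pnatr_eq0.
by rewrite /side opprD expfzDr // mulrCA exprN1 divff // mulr1.
Qed.

Lemma ltr_side (R : realType) (k k' : int) : (side k < side k' :> R) = (k' < k).
Proof. by rewrite /side ltr_eXz2l ?ltrN2// ltr1n. Qed.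

(** The minimal [N] with [s < 2^(N - M)] works; it is positive because [M] is
    taken so large that [2^-M <= s]. *)
Lemma side_between (R : realType) (s : R) :
  0 < s -> exists k : int, s < side k <= 2 * s.
Proof.
move=> s0.
have [M sM] : exists M : nat, side M%:Z <= s.
  exists (Num.bound s^-1).
  rewrite /side -exprz_inv -exprnP exprVn -[leRHS]invrK.
  rewrite lef_pV2 ?posrE ?exprn_gt0 ?invr_gt0 //.
  by apply: ltW; exact: upper_nthrootP (leqnn _).
have exN : exists N : nat, s < side (M%:Z - N%:Z).
  have [N sN] : exists N : nat, s / side M%:Z < 2 ^+ N.
    by exists (Num.bound (s / side M%:Z)); exact: upper_nthrootP (leqnn _).
  exists N; rewrite /side opprB expfzDr ?pnatr_eq0 //.
  by rewrite -ltr_pdivrMr // side_gt0.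
have [[|N] sN minN] := ex_minnP exN.
  by move: sN; rewrite subr0 ltNge sM.
exists (M%:Z - N.+1%:Z); rewrite sN /= sideS ler_pM2l; last by lra.
rewrite leNgt; apply/negP => sN'.
have := minN N; rewrite (_ : M%:Z - N%:Z = M%:Z - N.+1%:Z + 1); last by lia.
by move=> /(_ sN'); rewrite ltnn.
Qed.

(** * Grids with coherent phases *)

(** The integer [floor (2 u + q)] determines [floor (2 u)], whose integer half
    is [floor u]: in one dimension, a cell of a grid determines the cell of the
    coarser grid around it. *)
Lemma floor_coarsen (R : realType) (u v : R) (q : int) :
  Num.floor (2 * u + q%:~R) = Num.floor (2 * v + q%:~R) ->
  Num.floor u = Num.floor v.
Proof.
suff le (a b : R) : Num.floor (2 * a + q%:~R) = Num.floor (2 * b + q%:~R) ->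
    Num.floor a <= Num.floor b.
  by move=> uv; apply: le_anti; rewrite !le.
move=> ab; rewrite leNgt -lezD1 floor_ge_int; apply/negP => ba.
have := floorD1_gt b; have := floor_le a; set m := Num.floor b in ba * => _ bm.
have aq : 2 * m + 2 + q <= Num.floor (2 * a + q%:~R).
  by rewrite floor_ge_int !rmorphD /= rmorphM /=; move: ba; rewrite rmorphD /=; lra.
have bq : Num.floor (2 * b + q%:~R) < 2 * m + 2 + q.
  by rewrite floor_lt_int !rmorphD /= rmorphM /=; move: bm; rewrite rmorphD /=; lra.
by rewrite ab in aq; have := le_lt_trans aq bq; rewrite ltxx.
Qed.

Definition grid_index (R : realType) (n : nat) (theta : int -> R) (k : int)
    (x : 'rV[R]_n) : 'rV[int]_n :=
  \row_i Num.floor (x 0 i / side k - theta k).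

Definition shifted_grid (R : realType) (n : nat) (theta : int -> R) :
    cube_system R n :=
  fun k j => half_open_cube (\row_i (side k * ((j 0 i)%:~R + theta k))) (side k).

Lemma shifted_gridE (R : realType) (n : nat) (theta : int -> R) (k : int)
    (j : 'rV[int]_n) (x : 'rV[R]_n) :
  shifted_grid theta k j x <-> grid_index theta k x = j.
Proof.
have s0 := side_gt0 R k.
have E i : (x 0 i \in `[side k * ((j 0 i)%:~R + theta k),
    side k * ((j 0 i)%:~R + theta k) + side k[) =
    (Num.floor (x 0 i / side k - theta k) == j 0 i).
  rewrite floor_eq in_itv /= lerBrDr ltrBlDr ler_pdivlMr // ltr_pdivrMr //.
  by rewrite rmorphD /= addrAC [in RHS]mulrC [in RHS]mulrDl mul1r [in RHS](mulrC _ (side k)).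
split=> [xj|xj i]; last by rewrite mxE E -xj mxE.
by apply/rowP => i; apply/eqP; rewrite mxE -E; have := xj i; rewrite mxE.
Qed.

(** The endpoints of generation [k] in dimension one, [2^-k (Z + theta k)], are
    among those of generation [k + 1] exactly when this holds. *)
Definition coherent (R : realType) (theta : int -> R) :=
  forall k : int, exists q : int, theta (k + 1) = 2 * theta k + q%:~R.

Lemma grid_index_coarsen (R : realType) (n : nat) (theta : int -> R) :
  coherent theta -> forall (k k' : int) (x y : 'rV[R]_n), k <= k' ->
  grid_index theta k' x = grid_index theta k' y ->
  grid_index theta k x = grid_index theta k y.
Proof.
move=> thetaP k k' x y kk'.
have -> : k' = k + `|k' - k|%N by lia.
elim: `|k' - k|%N => [|d IH]; first by rewrite addr0.
rewrite -[d.+1]addn1 PoszD addrA => xy; apply: IH; apply/rowP => i.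
have [q qE] := thetaP (k + d); move/rowP: xy => /(_ i).
rewrite !mxE qE (sideS R (k + d)); set s := side _; have s0 : s != 0.
  by rewrite gt_eqF // side_gt0.
have E z : z / s - (2 * theta (k + d) + q%:~R) =
    2 * (z / (2 * s) - theta (k + d)) + (- q)%:~R.
  by rewrite rmorphN /=; field.
by rewrite !E; exact: floor_coarsen.
Qed.

(** Cells are the fibres of [grid_index], so the partition property is
    immediate, and nestedness says that finer indices determine coarser ones. *)
Lemma shifted_grid_dyadic (R : realType) (n : nat) (theta : int -> R) :
  coherent theta -> dyadic_filtration (@shifted_grid R n theta).
Proof.
move=> thetaP; split.
- by move=> k j; eexists.
- move=> k; split.
  + apply/seteqP; split => // x _; exists (shifted_grid theta k (grid_index theta k x)).
      by exists (grid_index theta k x).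
    exact/shifted_gridE.
  + move=> _ _ [j _ <-] [j' _ <-] [x [/shifted_gridE xj /shifted_gridE xj']].
    by rewrite -xj xj'.
  + move=> _ [j _ <-]; pose a := \row_i (side k * ((j 0 i)%:~R + theta k)).
    by exists a => i; rewrite in_itv /= lexx ltrDl side_gt0.
have nested k k' j j' : k <= k' ->
    shifted_grid theta k j `&` shifted_grid theta k' j' !=set0 ->
    shifted_grid theta k' j' `<=` @shifted_grid R n theta k j.
  move=> kk' [x [/shifted_gridE <- /shifted_gridE <-]] y /shifted_gridE yx.
  by apply/shifted_gridE; exact: grid_index_coarsen kk' yx.
move=> _ _ [k _ [j _ <-]] [k' _ [j' _ <-]].
have [ne|/set0P/negP/negPn/eqP] := pselect
  (shifted_grid theta k j `&` shifted_grid theta k' j' !=set0);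
  last by constructor 1.
have [kk'|k'k] := leP k k'; first by constructor 3; exact: nested.
by constructor 2; apply: nested (ltW k'k) _; rewrite setIC.
Qed.

(** * Separated phases *)

(** Pigeonhole: a phase [i] is bad when, for some [l], a point of [Z + theta i]
    separates [u l] from [v l].  Were all [n+1] phases bad, two of them would be so
    in the same coordinate [l], and an interval shorter than [e] would contain
    points of two [e]-separated lattices. *)
Lemma far_phase_exists (R : realType) (n : nat) (theta : 'I_n.+1 -> R)
    (e : R) (u v : 'I_n -> R) :
  (forall i i' (N : int), i != i' -> e <= `|theta i - theta i' + N%:~R|) ->
  (forall l, u l <= v l < u l + e) ->
  exists i, forall l, Num.floor (u l - theta i) = Num.floor (v l - theta i).
Proof.
move=> sep uv; apply: contrapT => /forallNP bad.
have /choice [f fP] : forall i, exists l,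
    Num.floor (u l - theta i) <> Num.floor (v l - theta i).
  by move=> i; exact/existsNP/bad.
have /injectivePn [i [i' ii' fii']] : ~~ injectiveb f.
  by apply/injectiveP => /leq_card; rewrite !card_ord ltnn.
(* The endpoint [theta k + N] found here separates [u] and [v] in the bad
   coordinate of phase [k]. *)
have jump k : exists N : int, u (f k) < theta k + N%:~R <= v (f k).
  exists (Num.floor (v (f k) - theta k)); have /andP[uvk _] := uv (f k).
  have := floor_le (v (f k) - theta k).
  suff : u (f k) - theta k < (Num.floor (v (f k) - theta k))%:~R by lra.
  rewrite -floor_lt_int lt_neqAle; apply/andP; split; first exact/eqP/fP.
  by apply: le_floor; lra.
have [N /andP[uN Nv]] := jump i; have [N' /andP[uN' Nv']] := jump i'.
have := sep i i' (N - N') ii'; have /andP[_] := uv (f i).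
rewrite -fii' in uN' Nv'; rewrite leNgt => uve /negP; apply.
rewrite ltr_norml rmorphB /=; lra.
Qed.

(** The generation is chosen so that the diameter of the ball, in units of the
    side, lies between [e / 2] and [e]. *)
Lemma shifted_grids_cover (R : realType) (n : nat)
    (theta : 'I_n.+1 -> int -> R) (e : R) :
  (0 < n)%N -> 0 < e ->
  (forall k i i' (N : int), i != i' ->
     e <= `|theta i k - theta i' k + N%:~R|) ->
  covers_balls (fun i => @shifted_grid R n (theta i)) (8 * n%:R / e).
Proof.
move=> n0 e0 sep x r r0.
have re0 : 0 < 2 * r / e by apply: divr_gt0 => //; lra.
have [k /andP[lk uk]] := side_between re0.
have s0 := side_gt0 R k.
pose u l := (x 0 l - r) / side k; pose v l := (x 0 l + r) / side k.
have [l|i iP] := @far_phase_exists _ _ (theta^~ k) e u v (sep k).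
  rewrite /u /v ler_pM2r ?invr_gt0 // ltr_pdivrMr // mulrDl divfK ?gt_eqF //.
  by move: lk; rewrite ltr_pdivrMr // [side k * e]mulrC => lk; apply/andP; split; lra.
pose j : 'rV[int]_n := \row_l Num.floor (u l - theta i k).
exists (shifted_grid (theta i) k j); split.
- by exists i => //; exists k => //; exists j.
- move=> y xy; apply/shifted_gridE; apply/rowP => l; rewrite !mxE.
  have := le_lt_trans (ler_coord_eucl_dist x y l) xy.
  rewrite ltr_norml => /andP[ly uy].
  apply/le_anti/andP; split; [rewrite iP|]; apply: le_floor; rewrite lerB //.
    by rewrite ler_pM2r ?invr_gt0 //; lra.
  by rewrite ler_pM2r ?invr_gt0 //; lra.
apply: (@le_trans _ _ (n%:R * side k)).
  by apply: diam_le => [|y z yQ zQ l]; [exact: ltW | exact: half_open_cube_bound yQ zQ].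
apply: (@le_trans _ _ (8 * n%:R / e * (r / 2))).
  rewrite (_ : 8 * _ / e * _ = n%:R * (2 * (2 * r / e))); last by field; lra.
  by rewrite ler_wpM2l.
rewrite ler_wpM2l ?diam_eucl_ball_ge //.
by apply: divr_ge0; [rewrite mulr_ge0|exact: ltW].
Qed.

(** The class of [2 ^ k] modulo [2n + 1]; for negative [k] one uses that [n + 1]
    is the inverse of 2. *)
Definition phase_multiplier (n : nat) (k : int) : nat :=
  match k with Posz a => 2 ^ a | Negz a => n.+1 ^ a.+1 end.

Definition phase (R : realType) (n : nat) (i : nat) (k : int) : R :=
  (phase_multiplier n k * i)%:R / (n.*2.+1)%:R.

Lemma phase_multiplierS (n : nat) (k : int) :
  exists q : nat, (2 * phase_multiplier n k =
    phase_multiplier n (k + 1) + q * n.*2.+1)%N.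
Proof.
case: k => a.
  by exists 0%N; rewrite mul0n addn0 -expnS /= addn1.
exists (n.+1 ^ a)%N.
have -> : phase_multiplier n (Negz a + 1) = (n.+1 ^ a)%N.
  by case: a => // a; rewrite (_ : Negz a.+1 + 1 = Negz a) //; lia.
by rewrite /= expnS -muln2; ring.
Qed.

Lemma coprime_phase_multiplier (n : nat) (k : int) :
  coprime (phase_multiplier n k) n.*2.+1.
Proof.
case: k => a /=; apply: coprimeXl; first by rewrite coprime2n /= odd_double.
have : coprime (n.+1 * 2)%N n.*2.+1.
  by rewrite (_ : (n.+1 * 2 = n.*2.+2)%N) ?coprimeSn //; lia.
by rewrite coprimeMl => /andP[].
Qed.

Lemma phase_coherent (R : realType) (n i : nat) : coherent (@phase R n i).
Proof.
move=> k; have [q qE] := phase_multiplierS n k; exists (- (q * i)%:Z).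
have p0 : (n.*2.+1)%:R != 0 :> R by rewrite pnatr_eq0.
have := congr1 (fun m => m%:R : R) qE.
rewrite /phase rmorphN /= -pmulrn natrD !natrM => E.
have -> : (phase_multiplier n (k + 1))%:R =
    2 * (phase_multiplier n k)%:R - q%:R * (n.*2.+1)%:R :> R.
  by rewrite E addrK.
by field.
Qed.

(** Multiplied by [p = 2n+1], the quantity is the absolute value of an integer
    congruent to [t (i - i')] modulo [p]; it is not 0 because [t] is invertible
    modulo [p] and [0 < |i - i'| < p]. *)
Lemma phase_separated (R : realType) (n i i' : nat) (k N : int) :
  (i <= n)%N -> (i' <= n)%N -> i != i' ->
  (n.*2.+1)%:R^-1 <= `|phase R n i k - phase R n i' k + N%:~R| :> R.
Proof.
move=> lei lei' ii'; set t := phase_multiplier n k; set p := n.*2.+1.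
have p0 : (0 : R) < p%:R by rewrite ltr0n.
pose z : int := t%:Z * (i%:Z - i'%:Z) + N * p%:Z.
have -> : phase R n i k - phase R n i' k + N%:~R = z%:~R / p%:R :> R.
  rewrite /phase -/t -/p /z rmorphD !rmorphM rmorphB /= -!pmulrn.
  by field; rewrite gt_eqF.
rewrite normrM [`|_^-1|]gtr0_norm ?invr_gt0 // -[leLHS]mul1r.
rewrite ler_pM2r ?invr_gt0 // -intr_norm.
rewrite (_ : 1 = 1%:~R) // ler_int -gtz0_ge1 normr_gt0.
apply/negP => /eqP z0.
have : (p %| t * `|i%:Z - i'%:Z|)%N.
  rewrite -[t]/`|t%:Z|%N -abszM -[p]/`|p%:Z|%N -dvdzE; apply/dvdzP.
  by exists (- N); move: z0; rewrite /z; lia.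
rewrite Gauss_dvdr; last by rewrite coprime_sym; exact: coprime_phase_multiplier.
move=> /dvdn_leq; rewrite absz_gt0 subr_eq0 => /(_ ii'); rewrite /p; lia.
Qed.

Lemma dyadic_cover_exists (R : realType) (n : nat) :
  (0 < n)%N -> exists (c : R) (A : 'I_n.+1 -> cube_system R n),
      (forall i, dyadic_filtration (A i)) /\ covers_balls A c.
Proof.
move=> n0; exists (8 * n%:R / (n.*2.+1)%:R^-1).
exists (fun i : 'I_n.+1 => shifted_grid (phase R n i)); split=> [i|].
  exact/shifted_grid_dyadic/phase_coherent.
apply: shifted_grids_cover; rewrite ?invr_gt0 ?ltr0n // => k i i' N ii'.
by apply: phase_separated; rewrite ?leq_ord.
Qed.

(** * Points on the boundary of every filtration *)

(** The reverse inclusion is impossible since [Q] is strictly wider than [P]: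
    its corner [b] and the point at distance [side k] from it along an axis
    cannot both be in [P]. *)
Lemma dyadic_cube_nested (R : realType) (n : nat) (A : cube_system R n)
    (k k' : int) (P Q : set 'rV[R]_n) (x : 'rV[R]_n) :
  (0 < n)%N -> dyadic_filtration A -> generation A k P -> generation A k' Q ->
  k' < k -> P x -> Q x -> P `<=` Q.
Proof.
move=> n0 [cubeA _ nestA] AP AQ kk' Px Qx.
have [||PQ0|//|QP] := nestA P Q.
- by exists k.
- by exists k'.
- by have : (P `&` Q) x by []; rewrite PQ0.
have [jP _ Pj] := AP; have [jQ _ Qj] := AQ; pose i := Ordinal n0.
have [a aE] := cubeA k jP; have [b bE] := cubeA k' jQ.
rewrite -Pj -Qj aE bE -/(side k) -/(side k') in QP.
have lk : side k < side k' :> R by rewrite ltr_side.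
have s0 := side_gt0 R k.
have Qb : half_open_cube b (side k') b by move=> l; rewrite in_itv /=; lra.
have Qs : half_open_cube b (side k') (b + side k *: delta_mx 0 i).
  move=> l; rewrite in_itv !mxE /=.
  by case: (l == i); rewrite ?(mulr1, mulr0) /=; lra.
have := QP _ Qb i; have := QP _ Qs i; rewrite !in_itv !mxE !eqxx mulr1 /=.
rewrite ltrD2r => /andP[_ ba] /andP[ab _].
by have := le_lt_trans ab ba; rewrite ltxx.
Qed.

Lemma dyadic_cube_unique (R : realType) (n : nat) (A : cube_system R n)
    (k : int) (P Q : set 'rV[R]_n) (x : 'rV[R]_n) :
  dyadic_filtration A -> generation A k P -> generation A k Q ->
  P x -> Q x -> P = Q.
Proof.
move=> [_ partA _] AP AQ Px Qx; have [_ trivA _] := partA k.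
by apply: (trivA P Q AP AQ); exists x.
Qed.

Lemma dyadic_cube_of (R : realType) (n : nat) (A : cube_system R n)
    (k : int) (x : 'rV[R]_n) :
  dyadic_filtration A -> exists a : 'rV[R]_n,
    generation A k (half_open_cube a (side k)) /\ half_open_cube a (side k) x.
Proof.
move=> [cubeA partA _]; have [covA _ _] := partA k.
have : [set: 'rV[R]_n] x by [].
rewrite -covA => -[P AP Px]; have [j _ jP] := AP; have [a aE] := cubeA k j.
by exists a; rewrite /side -aE jP.
Qed.

Lemma half_open_cube_inj (R : realType) (n : nat) (a b : 'rV[R]_n) (l : R) :
  0 < l -> half_open_cube a l = half_open_cube b l -> a = b.
Proof.
move=> l0 ab; apply/rowP => i; apply: le_anti.
have aa : half_open_cube a l a by move=> j; rewrite in_itv /=; lra.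
have bb : half_open_cube b l b by move=> j; rewrite in_itv /=; lra.
rewrite ab in aa; rewrite -ab in bb.
by have := aa i; have := bb i; rewrite !in_itv /= => /andP[-> _] /andP[-> _].
Qed.

(** If the corner [b] of the child is strictly above the face of the parent
    orthogonal to axis [i], its projection [y] on that face lies in another
    child, which fills the lower half of the parent along axis [i].  That child
    contains [b] when [b] is below the mid-hyperplane, contradicting
    disjointness. *)
Lemma child_avoids_mid_hyperplane (R : realType) (n : nat)
    (A : cube_system R n) (k : int) (a b x : 'rV[R]_n) (i : 'I_n) :
  dyadic_filtration A ->
  generation A k (half_open_cube a (side k)) ->
  generation A (k + 1) (half_open_cube b (side (k + 1))) ->
  half_open_cube a (side k) x -> half_open_cube b (side (k + 1)) x ->
  ~ b 0 i < a 0 i + side (k + 1) < b 0 i + side (k + 1).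
Proof.
move=> dA Aa Ab ax bx /andP[ba ab].
have n0 : (0 < n)%N by exact: leq_ltn_trans (ltn_ord i).
have s0 := side_gt0 R (k + 1); have ks : k < k + 1 by rewrite ltzD1.
have sub := dyadic_cube_nested n0 dA Ab Aa ks bx ax.
have bb : half_open_cube b (side (k + 1)) b by move=> l; rewrite in_itv /=; lra.
pose y : 'rV[R]_n := \row_l (if l == i then a 0 i else b 0 l).
have ay : half_open_cube a (side k) y.
  move=> l; rewrite mxE; case: eqP => [->|_]; last exact: sub.
  by rewrite in_itv /= (sideS R k); lra.
have [b' [Ab' b'y]] := dyadic_cube_of (k + 1) y dA.
have sub' := dyadic_cube_nested n0 dA Ab' Aa ks b'y ay.
have bb' : half_open_cube b' (side (k + 1)) b'.
  by move=> l; rewrite in_itv /=; lra.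
have b'a : b' 0 i = a 0 i.
  have := sub' _ bb' i; have := b'y i; rewrite !in_itv mxE eqxx /=.
  by move=> /andP[? _] /andP[? _]; lra.
have b'b : half_open_cube b' (side (k + 1)) b.
  move=> l; have := b'y l; rewrite mxE; case: eqP => // -> _.
  have := sub _ bb i; rewrite !in_itv /= b'a => /andP[-> _] //.
have := dyadic_cube_unique dA Ab Ab' bb b'b => /(half_open_cube_inj s0) bE.
by rewrite bE b'a ltxx in ab.
Qed.

(** For [d > 0] this says that [x] is on the boundary of a cube in each
    generation of side less than [d]: balls around [x], however small, are not
    contained in cubes of these generations. *)
Definition ball_cubes_large (R : realType) (n : nat) (A : cube_system R n)
    (x : 'rV[R]_n) (d : R) : Prop :=
  forall (k : int) (P : set 'rV[R]_n) (r : R),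
    generation A k P -> 0 < r -> eucl_ball x r `<=` P -> d <= side k.

Lemma mid_hyperplane_ball_cubes_large (R : realType) (n : nat)
    (A : cube_system R n) (k : int) (a x : 'rV[R]_n) (i : 'I_n) :
  dyadic_filtration A -> generation A k (half_open_cube a (side k)) ->
  half_open_cube a (side k) x -> x 0 i = a 0 i + side (k + 1) ->
  ball_cubes_large A x (side k).
Proof.
move=> dA Aa ax xi k' P r AP r0 BP; rewrite leNgt; apply/negP; rewrite ltr_side.
have n0 : (0 < n)%N by exact: leq_ltn_trans (ltn_ord i).
have Px : P x by apply: BP; exact: eucl_ball_center.
have [b [Ab bx]] := dyadic_cube_of (k + 1) x dA.
rewrite -lezD1 le_eqVlt => kk'.
have Pb : P `<=` half_open_cube b (side (k + 1)).
  case/orP: kk' => [/eqP kk'|kk']; last exact: dyadic_cube_nested n0 dA AP Ab kk' Px bx.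
  rewrite -kk' in AP; have -> // := dyadic_cube_unique dA AP Ab Px bx.
have shift e : `|e| < r -> half_open_cube b (side (k + 1)) (x + e *: delta_mx 0 i).
  by move=> er; apply/Pb/BP/eucl_ball_shift.
apply: (child_avoids_mid_hyperplane (i := i) dA Aa Ab ax bx).
(* The ball has points on both sides of the mid-hyperplane. *)
have r2 : `|r / 2| < r by rewrite ger0_norm; lra.
have r2' : `|- (r / 2)| < r by rewrite normrN.
have := shift _ r2 i; have := shift _ r2' i.
rewrite !in_itv !mxE !eqxx !mulr1 /= -xi => /andP[? ?] /andP[? ?].
by apply/andP; split; lra.
Qed.

(** The first [t] coordinates of [x] are settled, and deal with the first [t]
    filtrations wherever the other coordinates move within [d].  The next stage
    takes a cube of filtration [t] around [x], of side less than [d], and moves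
    the free coordinates to its centre; it may do so with coordinate [t] frozen
    on the mid-hyperplane because [t < m <= n].  The new tolerance is half the
    side of this cube, which keeps all further points inside it. *)
Lemma common_boundary_point (R : realType) (n m : nat)
    (A : 'I_m -> cube_system R n) (t : nat) :
  (m <= n)%N -> (forall i, dyadic_filtration (A i)) -> (t <= m)%N ->
  exists (x : 'rV[R]_n) (d : R), 0 < d /\
    forall y : 'rV[R]_n,
      (forall l : 'I_n, if (l < t)%N then y 0 l = x 0 l
                        else `|y 0 l - x 0 l| < d) ->
      forall i : 'I_m, (i < t)%N -> ball_cubes_large (A i) y d.
Proof.
move=> mn dA; elim: t => [_|t IH tm]; first by exists 0, 1.
have [x [d [d0 xd]]] := IH (ltnW tm).
have d4 : 0 < d / 4 by lra.
have [k /andP[_ kd]] := side_between d4.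
pose i0 := Ordinal tm; pose l0 := Ordinal (leq_trans tm mn).
have [a [Aa ax]] := dyadic_cube_of k x (dA i0).
have s0 := side_gt0 R (k + 1); have sE := sideS R k.
exists (\row_l (if (l < t)%N then x 0 l else a 0 l + side (k + 1))), (side (k + 1)).
split=> // y yx.
have ay : half_open_cube a (side k) y.
  move=> l; have := yx l; rewrite mxE ltnS leq_eqVlt.
  case: (ltnP l t) => [lt|tl]; first by rewrite orbT => ->; exact: ax.
  rewrite orbF in_itv /=; case: eqP => _; first by move=> ->; lra.
  by rewrite ltr_norml => /andP[? ?]; lra.
move=> i; rewrite ltnS leq_eqVlt => /orP[/eqP it|it] k' P r AP r0 BP.
  have ii0 : i = i0 by exact: val_inj.
  have yl : y 0 l0 = a 0 l0 + side (k + 1).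
    by have := yx l0; rewrite mxE /= ltnSn ltnn.
  rewrite ii0 in AP.
  have := mid_hyperplane_ball_cubes_large (dA i0) Aa ay yl AP r0 BP; lra.
apply: le_trans (xd y _ i it k' P r AP r0 BP); first by lra.
move=> l; case: (ltnP l t) => lt.
  by have := yx l; rewrite mxE lt ltnS (ltnW lt).
by have := half_open_cube_bound l ay ax; lra.
Qed.

(** At a common boundary point, the ratio of diameters is unbounded: the cubes
    have side at least [d], whereas the radius tends to 0. *)
Lemma no_cover_of_few_filtrations (R : realType) (n m : nat)
    (A : 'I_m -> cube_system R n) (c : R) :
  (0 < n)%N -> (m <= n)%N -> (forall i, dyadic_filtration (A i)) ->
  ~ covers_balls A c.
Proof.
move=> n0 mn dA cov.
have [x [d [d0 xd]]] := common_boundary_point mn dA (leqnn m).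
have nR : 0 < n%:R :> R by rewrite ltr0n.
have c1 : 0 < `|c| + 1 by apply: ltr_wpDl.
(* With this radius, [c] times the diameter of the ball is at most [d / 4],
   while a cube of side at least [d] has diameter at least [d / 2]. *)
pose r := d / (8 * n%:R * (`|c| + 1)).
have r0 : 0 < r by rewrite divr_gt0 // !mulr_gt0.
have [P [[i _ [k _ AP]] BP Pc]] := cov x r r0.
have large : d <= side k.
  apply: (xd x _ i (ltn_ord i) k P r AP r0 BP) => l.
  by rewrite subrr normr0; case: ifP.
have Pk : side k / 2 <= diam P.
  have [j _ jP] := AP; have [a aE] := (let: And3 h _ _ := dA i in h) k j.
  by rewrite -jP aE; apply: diam_half_open_cube_ge => //; exact: side_gt0.
have B0 : 0 <= diam (eucl_ball x r).
  by apply: le_trans (diam_eucl_ball_ge x n0 r0); lra.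
have Br : diam (eucl_ball x r) <= n%:R * (2 * r).
  apply: diam_le => [|y z By Bz l]; [lra | exact: eucl_ball_bound By Bz].
have cB : c * diam (eucl_ball x r) <= (`|c| + 1) * (n%:R * (2 * r)).
  apply: (@le_trans _ _ ((`|c| + 1) * diam (eucl_ball x r))).
    by apply: ler_wpM2r => //; have := ler_norm c; lra.
  by rewrite ler_pM2l.
have rE : (`|c| + 1) * (n%:R * (2 * r)) = d / 4.
  by rewrite /r; field; rewrite !gt_eqF.
lra.
Qed.

Theorem theoremA (R : realType) (n : nat) (hn : (1 <= n)%N) :
  (exists (c : R) (A : 'I_n.+1 -> cube_system R n),
      (forall i : 'I_n.+1, dyadic_filtration (A i)) /\ covers_balls A c) /\
  (forall (m : nat) (A : 'I_m -> cube_system R n),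
      (m <= n)%N -> (forall i : 'I_m, dyadic_filtration (A i)) ->
      ~ exists c : R, covers_balls A c).
Proof.
split; first exact: dyadic_cover_exists.
by move=> m A mn dA [c]; exact: no_cover_of_few_filtrations.
Qed.
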